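(* In $\mathbb{K}\langle \mathbf{Mag}\rangle$, let $I_{\mathrm{As}}$ be the operad ideal generated by $\mathrm{LComb}_2-\mathrm{RComb}_2$, $I_{\mathrm{AAs}}$ the operad ideal generated by $\mathrm{LComb}_2+\mathrm{RComb}_2$, $I_{2\mathrm{Nil}}$ the operad ideal generated by $\mathrm{LComb}_2$ and $\mathrm{RComb}_2$, and $I_{\mathrm{RC}_3}$ the operad ideal generated by the elements $\mathfrak{t}-\mathrm{RComb}_3$ for all binary trees $\mathfrak{t}$ with $4$ leaves. Then, writing $\mathbb{K}\langle\mathbf{As}\rangle=\mathbb{K}\langle \mathbf{Mag}\rangle/_{I_{\mathrm{As}}}$, $\mathbf{AAs}=\mathbb{K}\langle \mathbf{Mag}\rangle/_{I_{\mathrm{AAs}}}$, $2\mathbf{Nil}=\mathbb{K}\langle \mathbf{Mag}\rangle/_{I_{2\mathrm{Nil}}}$ and $\mathbb{K}\langle\mathrm{RC}_3\rangle=\mathbb{K}\langle \mathbf{Mag}\rangle/_{I_{\mathrm{RC}_3}}$, we have $\mathbb{K}\langle\mathbf{As}\rangle\wedge_{\mathrm{i}}\mathbf{AAs}=2\mathbf{Nil}$ and $\mathbb{K}\langle\mathbf{As}\rangle\vee_{\mathrm{i}}\mathbf{AAs}=\mathbb{K}\langle\mathrm{RC}_3\rangle$; that is, $I_{\mathrm{As}}+I_{\mathrm{AAs}}=I_{2\mathrm{Nil}}$ and $I_{\mathrm{As}}\cap I_{\mathrm{AAs}}=I_{\mathrm{RC}_3}$.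
   Context: $\mathbb{K}$ is a field of characteristic zero. A binary tree is either the leaf or an ordered pair of binary trees; $\mathbf{Mag}(n)$ is the set of binary trees with $n$ leaves, and the nonsymmetric operad $\mathbf{Mag}$ has partial compositions grafting the root of a tree onto the $i$-th leaf of another. $\mathbb{K}\langle \mathbf{Mag}\rangle$ is the linear operad with $\mathbb{K}\langle \mathbf{Mag}\rangle(n)$ having basis $\mathbf{Mag}(n)$. Combs: $\mathrm{LComb}_1=\mathrm{RComb}_1=(\text{leaf},\text{leaf})$, $\mathrm{LComb}_d=(\mathrm{LComb}_{d-1},\text{leaf})$, $\mathrm{RComb}_d=(\text{leaf},\mathrm{RComb}_{d-1})$. An operad ideal is a family of subspaces stable under partial composition with arbitrary elements on either side; for quotients $\mathcal{O}_j=\mathbb{K}\langle \mathbf{Mag}\rangle/_{I_j}$, $\mathcal{O}_1\wedge_{\mathrm{i}}\mathcal{O}_2:=\mathbb{K}\langle \mathbf{Mag}\rangle/_{I_1+I_2}$ and $\mathcal{O}_1\vee_{\mathrm{i}}\mathcal{O}_2:=\mathbb{K}\langle \mathbf{Mag}\rangle/_{I_1\cap I_2}$. *)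

(* Defs.v *)
From HB Require Import structures.
From mathcomp Require Import all_boot all_algebra.
From mathcomp Require Import generic_quotient ring_quotient.
From mathcomp Require Import boolp classical_sets.
From mathcomp Require Import zify.

Set Implicit Arguments.
Unset Strict Implicit.
Unset Printing Implicit Defensive.

Import GRing.Theory.

Local Open Scope ring_scope.
Local Open Scope quotient_scope.
Local Open Scope classical_set_scope.

Lemma submod_closed_setP (K : fieldType) (V : lmodType K) (A : set V) :
  submod_closed [in A] <->
  A 0 /\ forall a x y, A x -> A y -> A (a *: x + y).
Proof.
split=> [[A0 AP]|[A0 AP]]; split.
- exact: set_mem A0.
- move=> a x y Ax Ay; apply: set_mem; apply: AP; exact: mem_set.
- exact: mem_set.
- move=> a x y /set_mem Ax /set_mem Ay; apply: mem_set; exact: AP.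
Qed.

Section LinearOperads.
Variable K : fieldType.

(* Inputs are numbered from 0 and [m + n - 1] is written [(m + n).-1].  Laws
   relating terms whose arities agree only propositionally are equalities in
   the total space [{n & carrier n}]. *)
Record ns_operad := NsOperad {
  carrier :> nat -> lmodType K;
  pcomp : forall m n : nat,
    'I_m -> carrier m -> carrier n -> carrier (m + n).-1;
  unit_op : carrier 1;
  pcompDl : forall m n (i : 'I_m) a (x x' : carrier m) (y : carrier n),
    pcomp i (a *: x + x') y = a *: pcomp i x y + pcomp i x' y;
  pcompDr : forall m n (i : 'I_m) a (x : carrier m) (y y' : carrier n),
    pcomp i x (a *: y + y') = a *: pcomp i x y + pcomp i x y';
  pcomp1 : forall m (i : 'I_m) (x : carrier m),
    existT carrier _ (pcomp i x unit_op) = existT carrier m x;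
  pcomp_1 : forall n (y : carrier n), pcomp ord0 unit_op y = y;
  pcomp_seq : forall m n p (i : 'I_m) (j : 'I_n) (k : 'I_(m + n).-1)
      (x : carrier m) (y : carrier n) (z : carrier p), k = (i + j)%N :> nat ->
    existT carrier _ (pcomp k (pcomp i x y) z)
    = existT carrier _ (pcomp i x (pcomp j y z));
  pcomp_par : forall m n p (i k : 'I_m)
      (k' : 'I_(m + n).-1) (i' : 'I_(m + p).-1)
      (x : carrier m) (y : carrier n) (z : carrier p),
    (i < k)%N -> k' = (k + n).-1%N :> nat -> i' = i :> nat ->
    existT carrier _ (pcomp k' (pcomp i x y) z)
    = existT carrier _ (pcomp i' (pcomp k x z) y)
}.

Definition graded (O : ns_operad) n (x : O n) : {n & O n} :=
  existT (fun n => O n) n x.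

Section Ideals.
Variable O : ns_operad.

Definition is_operad_ideal (I : forall n, set (O n)) : Prop :=
  [/\ forall n, submod_closed [in I n],
      forall m n (i : 'I_m) (x : O m) (y : O n),
        I m x -> I _ (pcomp i x y)
    & forall m n (i : 'I_m) (x : O m) (y : O n),
        I n y -> I _ (pcomp i x y)].

Record operad_ideal := OperadIdeal {
  ideal_set :> forall n, set (O n);
  ideal_setP : is_operad_ideal ideal_set
}.

Lemma operad_ideal_ext (I J : operad_ideal) :
  (forall n, I n = J n) -> I = J.
Proof.
case: I J => [I HI] [J HJ] /= IJ.
have eIJ : I = J by apply: functional_extensionality_dep.
by subst J; congr OperadIdeal; apply: Prop_irrelevance.
Qed.

Section IdealTheory.
Variable I : operad_ideal.

Lemma ideal0 n : I n 0.
Proof. by case: I => J [/= + _ _] => /(_ n)/submod_closed_setP[]. Qed.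

Lemma idealP n a (x y : O n) : I n x -> I n y -> I n (a *: x + y).
Proof.
by case: I => J [/= + _ _] => /(_ n)/submod_closed_setP[_]; apply.
Qed.

Lemma ideal_pcompl m n (i : 'I_m) (x : O m) (y : O n) :
  I m x -> I _ (pcomp i x y).
Proof. by case: I => J [/= _ + _]; apply. Qed.

Lemma ideal_pcompr m n (i : 'I_m) (x : O m) (y : O n) :
  I n y -> I _ (pcomp i x y).
Proof. by case: I => J [/= _ _]; apply. Qed.

End IdealTheory.

Lemma is_operad_ideal_gen (G : set {n & O n}) :
  is_operad_ideal (fun n => [set x | forall J : operad_ideal,
    (forall g, G g -> J (projT1 g) (projT2 g)) -> J n x]).
Proof.
split=> [n|m n i x y Ix J GJ|m n i x y Iy J GJ].
- apply/submod_closed_setP; split=> [|a x y] /= => [J _|Ix Iy J GJ]; first exact: ideal0.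
  by apply: idealP; [apply: Ix | apply: Iy].
- by apply: ideal_pcompl; apply: Ix.
- by apply: ideal_pcompr; apply: Iy.
Qed.

(* The ideal generated by a set of elements of arbitrary arities: the
   intersection of all the ideals containing it. *)
Definition gen_ideal (G : set {n & O n}) : operad_ideal :=
  OperadIdeal (is_operad_ideal_gen G).

Lemma is_operad_ideal_sum (I J : operad_ideal) :
  is_operad_ideal (fun n => [set x + y | x in I n & y in J n]).
Proof.
split=> [n|m n i _ z [x Ix [y Jy <-]]|m n i z _ [x Ix [y Jy <-]]].
- apply/submod_closed_setP; split=> [|a u v] /=.
    by exists 0; [exact: ideal0 | exists 0; [exact: ideal0 | rewrite addr0]].
  move=> [x Ix [y Jy <-]] [x' Ix' [y' Jy' <-]].
  exists (a *: x + x'); first exact: idealP.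
  exists (a *: y + y'); first exact: idealP.
  by rewrite scalerDr addrACA.
- exists (pcomp i x z); first exact: ideal_pcompl.
  exists (pcomp i y z); first exact: ideal_pcompl.
  by rewrite -[x]scale1r pcompDl !scale1r.
- exists (pcomp i z x); first exact: ideal_pcompr.
  exists (pcomp i z y); first exact: ideal_pcompr.
  by rewrite -[x]scale1r pcompDr !scale1r.
Qed.

Definition ideal_sum (I J : operad_ideal) : operad_ideal :=
  OperadIdeal (is_operad_ideal_sum I J).

Lemma is_operad_ideal_cap (I J : operad_ideal) :
  is_operad_ideal (fun n => I n `&` J n).
Proof.
split=> [n|m n i x y [Ix Jx]|m n i x y [Iy Jy]].
- apply/submod_closed_setP; split=> [|a u v] /=; first by split; exact: ideal0.
  by move=> [Iu Ju] [Iv Jv]; split; apply: idealP.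
- by split; apply: ideal_pcompl.
- by split; apply: ideal_pcompr.
Qed.

Definition ideal_cap (I J : operad_ideal) : operad_ideal :=
  OperadIdeal (is_operad_ideal_cap I J).

End Ideals.

Section Quotient.
Variables (O : ns_operad) (I : operad_ideal O).

Definition ideal_pred n : {pred O n} := fun x => x \in I n.

Lemma ideal_pred_zmod_closed n : zmod_closed (@ideal_pred n).
Proof.
split=> [|x y]; first exact/mem_set/ideal0.
move=> /set_mem Ix /set_mem Iy; apply: mem_set.
by rewrite addrC -scaleN1r; exact: idealP.
Qed.

HB.instance Definition _ n :=
  GRing.isZmodClosed.Build (O n) (@ideal_pred n) (ideal_pred_zmod_closed n).

Definition quot_carrier n : Type := Quotient.quot (@ideal_pred n : zmodClosed (O n)).

HB.instance Definition _ n := GRing.Zmodule.on (quot_carrier n).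
HB.instance Definition _ n := generic_quotient.Quotient.on (quot_carrier n).


Lemma quot_eqP n (x y : O n) :
  \pi_(quot_carrier n) x = \pi_(quot_carrier n) y <-> I n (x - y).
Proof.
split=> [/eqP|Ixy].
  by rewrite -Quotient.idealrBE unfold_in /= inE.
by apply/eqP; rewrite -Quotient.idealrBE unfold_in /= inE.
Qed.

Definition quot_scale n (a : K) : quot_carrier n -> quot_carrier n :=
  lift_op1 (quot_carrier n) ( *:%R a).

Lemma pi_quot_scale n a (x : O n) :
  \pi_(quot_carrier n) (a *: x) = quot_scale a (\pi x).
Proof.
rewrite /quot_scale -lock; apply/quot_eqP.
rewrite -scalerBr -[_ *: _]addr0.
apply: idealP; last exact: ideal0.
by apply/quot_eqP; rewrite reprK.
Qed.

Lemma pi_quot_add n (x y : O n) :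
  \pi_(quot_carrier n) (x + y) = \pi x + \pi y :> quot_carrier n.
Proof. exact: (Quotient.pi_add (@ideal_pred n : zmodClosed (O n))). Qed.

Lemma quot_scaleA n a b (x : quot_carrier n) :
  quot_scale a (quot_scale b x) = quot_scale (a * b) x.
Proof. by rewrite -[x]reprK -!pi_quot_scale scalerA. Qed.

Lemma quot_scale1 n : left_id 1 (@quot_scale n).
Proof. by move=> x; rewrite -[x]reprK -pi_quot_scale scale1r. Qed.

Lemma quot_scaleDr n : right_distributive (@quot_scale n) +%R.
Proof.
move=> a x y; rewrite -[x]reprK -[y]reprK.
by rewrite -pi_quot_add -!pi_quot_scale scalerDr pi_quot_add.
Qed.

Lemma quot_scaleDl n (x : quot_carrier n) :
  {morph (@quot_scale n)^~ x : a b / a + b}.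
Proof.
move=> a b; rewrite -[x]reprK.
by rewrite -!pi_quot_scale scalerDl pi_quot_add.
Qed.

HB.instance Definition _ n := GRing.Zmodule_isLmodule.Build K (quot_carrier n)
  (@quot_scaleA n) (@quot_scale1 n) (@quot_scaleDr n) (@quot_scaleDl n).

Lemma pi_quotP n a (x y : O n) : \pi_(quot_carrier n) (a *: x + y)
  = a *: (\pi x : quot_carrier n) + \pi y.
Proof. by rewrite pi_quot_add pi_quot_scale. Qed.

Definition quot_pcomp m n (i : 'I_m) :
    quot_carrier m -> quot_carrier n -> quot_carrier (m + n).-1 :=
  locked (fun x y => \pi_(quot_carrier _) (pcomp i (repr x) (repr y))).

Lemma pi_quot_pcomp m n (i : 'I_m) (x : O m) (y : O n) :
  \pi_(quot_carrier _) (pcomp i x y) = quot_pcomp i (\pi x) (\pi y).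
Proof.
rewrite /quot_pcomp -lock; apply/quot_eqP; set x' := repr _; set y' := repr _.
have Ix : I m (x - x') by apply/quot_eqP; rewrite reprK.
have Iy : I n (y - y') by apply/quot_eqP; rewrite reprK.
have -> : pcomp i x y - pcomp i x' y'
    = 1 *: pcomp i (x - x') y + pcomp i x' (y - y').
  have Bl : pcomp i (x - x') y = pcomp i x y - pcomp i x' y.
    by rewrite addrC -scaleN1r pcompDl scaleN1r addrC.
  have Br : pcomp i x' (y - y') = pcomp i x' y - pcomp i x' y'.
    by rewrite addrC -scaleN1r pcompDr scaleN1r addrC.
  by rewrite Bl Br scale1r addrA subrK.
by apply: idealP; [exact: ideal_pcompl | exact: ideal_pcompr].
Qed.

Definition quot_unit : quot_carrier 1 := \pi_(quot_carrier 1) (unit_op O).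

Lemma existT_pi m n (x : O m) (y : O n) :
  graded x = graded y ->
  existT quot_carrier m (\pi_(quot_carrier m) x)
  = existT quot_carrier n (\pi_(quot_carrier n) y).
Proof.
pose f (u : {n & O n}) :=
  existT quot_carrier (projT1 u) (\pi_(quot_carrier (projT1 u)) (projT2 u)).
by move=> /(congr1 f).
Qed.

Fact quot_pcompDl m n (i : 'I_m) a (x x' : quot_carrier m) (y : quot_carrier n) :
  quot_pcomp i (a *: x + x') y = a *: quot_pcomp i x y + quot_pcomp i x' y.
Proof.
rewrite -[x]reprK -[x']reprK -[y]reprK -pi_quotP.
by rewrite -!pi_quot_pcomp pcompDl pi_quotP.
Qed.

Fact quot_pcompDr m n (i : 'I_m) a (x : quot_carrier m) (y y' : quot_carrier n) :
  quot_pcomp i x (a *: y + y') = a *: quot_pcomp i x y + quot_pcomp i x y'.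
Proof.
rewrite -[x]reprK -[y]reprK -[y']reprK -pi_quotP.
by rewrite -!pi_quot_pcomp pcompDr pi_quotP.
Qed.

Fact quot_pcomp1 m (i : 'I_m) (x : quot_carrier m) :
  existT quot_carrier _ (quot_pcomp i x quot_unit) = existT quot_carrier m x.
Proof. by rewrite -[x]reprK -pi_quot_pcomp; exact/existT_pi/pcomp1. Qed.

Fact quot_pcomp_1 n (y : quot_carrier n) : quot_pcomp ord0 quot_unit y = y.
Proof. by rewrite -[y]reprK -pi_quot_pcomp pcomp_1. Qed.

Fact quot_pcomp_seq m n p (i : 'I_m) (j : 'I_n) (k : 'I_(m + n).-1)
    (x : quot_carrier m) (y : quot_carrier n) (z : quot_carrier p) :
  k = (i + j)%N :> nat ->
  existT quot_carrier _ (quot_pcomp k (quot_pcomp i x y) z)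
  = existT quot_carrier _ (quot_pcomp i x (quot_pcomp j y z)).
Proof.
rewrite -[x]reprK -[y]reprK -[z]reprK -!pi_quot_pcomp => kE.
exact/existT_pi/pcomp_seq.
Qed.

Fact quot_pcomp_par m n p (i k : 'I_m)
    (k' : 'I_(m + n).-1) (i' : 'I_(m + p).-1)
    (x : quot_carrier m) (y : quot_carrier n) (z : quot_carrier p) :
  (i < k)%N -> k' = (k + n).-1%N :> nat -> i' = i :> nat ->
  existT quot_carrier _ (quot_pcomp k' (quot_pcomp i x y) z)
  = existT quot_carrier _ (quot_pcomp i' (quot_pcomp k x z) y).
Proof.
rewrite -[x]reprK -[y]reprK -[z]reprK -!pi_quot_pcomp => ik k'E i'E.
exact/existT_pi/pcomp_par.
Qed.

Definition quot_operad : ns_operad :=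
  NsOperad quot_pcompDl quot_pcompDr quot_pcomp1 quot_pcomp_1
    quot_pcomp_seq quot_pcomp_par.

End Quotient.

Section MeetJoin.
Variable O : ns_operad.

(* A quotient of [O] together with its presentation, on which the lattice
   operations below depend. *)
Record operad_quotient := OperadQuotient { rel_ideal : operad_ideal O }.

Definition operad_of_quotient (Q : operad_quotient) : ns_operad :=
  quot_operad (rel_ideal Q).

Definition meet_i (Q1 Q2 : operad_quotient) : operad_quotient :=
  OperadQuotient (ideal_sum (rel_ideal Q1) (rel_ideal Q2)).

Definition join_i (Q1 Q2 : operad_quotient) : operad_quotient :=
  OperadQuotient (ideal_cap (rel_ideal Q1) (rel_ideal Q2)).

End MeetJoin.
End LinearOperads.

Coercion operad_of_quotient : operad_quotient >-> ns_operad.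

Inductive bintree := Leaf | Node of bintree & bintree.

Fixpoint bintree_code (t : bintree) : GenTree.tree unit :=
  if t is Node l r then GenTree.Node 0 [:: bintree_code l; bintree_code r]
  else GenTree.Leaf tt.

Fixpoint bintree_decode (c : GenTree.tree unit) : bintree :=
  if c is GenTree.Node _ [:: l; r] then
    Node (bintree_decode l) (bintree_decode r)
  else Leaf.

Lemma bintree_codeK : cancel bintree_code bintree_decode.
Proof. by elim=> //= l -> r ->. Qed.

HB.instance Definition _ := Countable.copy bintree (can_type bintree_codeK).

Fixpoint leaves (t : bintree) : nat :=
  if t is Node l r then (leaves l + leaves r)%N else 1.

Lemma leaves_gt0 t : (0 < leaves t)%N.
Proof. by elim: t => //= l IHl r IHr; rewrite addn_gt0 IHl. Qed.

(* [graft s i t] replaces the [i]-th leaf of [s], counted from 0 and from left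
   to right, by [t]. *)
Fixpoint graft (s : bintree) (i : nat) (t : bintree) : bintree :=
  if s is Node l r then
    if (i < leaves l)%N then Node (graft l i t) r
    else Node l (graft r (i - leaves l) t)
  else t.

Lemma leaves_graft s i t : (i < leaves s)%N ->
  leaves (graft s i t) = (leaves s + leaves t).-1.
Proof.
have := leaves_gt0 t.
elim: s i => [|l IHl r IHr] i t0 /=; first by lia.
by case: (ltnP i (leaves l)) => il ir /=; rewrite ?IHl ?IHr //; lia.
Qed.

Lemma graft_leaf s i : graft s i Leaf = s.
Proof. by elim: s i => //= l IHl r IHr i; rewrite IHl IHr; case: ifP. Qed.

Lemma graft_seq s t u i j : (i < leaves s)%N -> (j < leaves t)%N ->
  graft (graft s i t) (i + j) u = graft s i (graft t j u).
Proof.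
elim: s i => [|l IHl r IHr] i /= il jl; first by have -> : i = 0%N by lia.
case: (ltnP i (leaves l)) => ill /=.
  by rewrite leaves_graft // ifT ?IHl //; lia.
rewrite ifF; last by lia.
have -> : (i + j - leaves l = i - leaves l + j)%N by lia.
by rewrite IHr //; lia.
Qed.

Lemma graft_par s t u i k : (i < k < leaves s)%N ->
  graft (graft s i t) (k + leaves t).-1 u = graft (graft s k u) i t.
Proof.
have t0 := leaves_gt0 t; have u0 := leaves_gt0 u.
elim: s i k => [|l IHl r IHr] i k /= ik; first by lia.
case: (ltnP i (leaves l)) => il; case: (ltnP k (leaves l)) => kl /=.
- rewrite !leaves_graft // !ifT ?IHl //; lia.
- rewrite leaves_graft // il ifF; last by lia.
  by congr (Node _ (graft _ _ _)); lia.
- by lia.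
- rewrite !ifF; try lia.
  rewrite -IHr; last by lia.
  by congr (Node _ (graft _ _ _)); lia.
Qed.

Fixpoint bintrees_upto (h : nat) : seq bintree :=
  if h is h'.+1 then
    Leaf :: [seq Node l r | l <- bintrees_upto h', r <- bintrees_upto h']
  else [::].

Lemma bintrees_upto_uniq h : uniq (bintrees_upto h).
Proof.
elim: h => //= h IHh; apply/andP; split; first by apply/allpairsP => -[[]] ? ? [].
by apply: allpairs_uniq => // -[l r] [l' r'] _ _ /= [-> ->].
Qed.

Lemma mem_bintrees_upto h t : (leaves t <= h)%N -> t \in bintrees_upto h.
Proof.
elim: h t => [|h IHh] [|l r] //=; first by rewrite leqNgt addn_gt0 leaves_gt0.
have := leaves_gt0 l; have := leaves_gt0 r => r0 l0 lr.
by rewrite in_cons /=; apply: allpairs_f; apply: IHh; lia.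
Qed.

Definition Mag (n : nat) := {t : bintree | leaves t == n}.

Definition Mag_enum n : seq (Mag n) := pmap insub (bintrees_upto n).

Lemma Mag_enumP n : Finite.axiom (@Mag_enum n).
Proof.
move=> t; rewrite count_uniq_mem ?pmap_sub_uniq ?bintrees_upto_uniq //.
by rewrite mem_pmap_sub mem_bintrees_upto // (eqP (valP t)).
Qed.

HB.instance Definition _ n := Countable.on (Mag n).
HB.instance Definition _ n := isFinite.Build (Mag n) (@Mag_enumP n).

Lemma mag_graft_subproof m n (i : 'I_m) (s : Mag m) (t : Mag n) :
  leaves (graft (val s) i (val t)) == (m + n).-1.
Proof.
by case: s t => s /= /eqP sm [t /= /eqP tn]; rewrite leaves_graft ?sm ?tn.
Qed.

Definition mag_graft m n (i : 'I_m) (s : Mag m) (t : Mag n) : Mag (m + n).-1 :=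
  Sub (graft (val s) i (val t)) (mag_graft_subproof i s t).

Definition mag_leaf : Mag 1 := Sub Leaf (eqxx 1%N).

(* [lcomb 0] and [rcomb 0] are the leaf. *)
Fixpoint lcomb (d : nat) : bintree :=
  if d is d'.+1 then Node (lcomb d') Leaf else Leaf.

Fixpoint rcomb (d : nat) : bintree :=
  if d is d'.+1 then Node Leaf (rcomb d') else Leaf.

Lemma leaves_lcomb d : leaves (lcomb d) == d.+1.
Proof. by elim: d => //= d /eqP->; rewrite addn1. Qed.

Lemma leaves_rcomb d : leaves (rcomb d) == d.+1.
Proof. by elim: d => //= d /eqP->. Qed.

Definition LComb d : Mag d.+1 := Sub (lcomb d) (leaves_lcomb d).
Definition RComb d : Mag d.+1 := Sub (rcomb d) (leaves_rcomb d).

Section KMag.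
Variable K : fieldType.

Definition KMag_carrier (n : nat) : lmodType K := {ffun Mag n -> K^o}.

Definition tree_vec n (t : Mag n) : KMag_carrier n :=
  [ffun s => (s == t)%:R : K^o].

Definition KMag_pcomp m n (i : 'I_m)
    (x : KMag_carrier m) (y : KMag_carrier n) : KMag_carrier (m + n).-1 :=
  \sum_(s : Mag m) \sum_(t : Mag n) (x s * y t) *: tree_vec (mag_graft i s t).

Definition KMag_unit : KMag_carrier 1 := tree_vec mag_leaf.

Lemma tree_vecE n (x : KMag_carrier n) : x = \sum_t x t *: tree_vec t.
Proof.
apply/ffunP => s; rewrite sum_ffunE (bigD1 s) //= big1 => [|t ts].
  by rewrite !ffunE eqxx addr0 [_ *: _]mulr1.
by rewrite !ffunE eq_sym (negPf ts) [_ *: _]mulr0.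
Qed.

Fact KMag_pcompDl m n (i : 'I_m) a (x x' : KMag_carrier m) (y : KMag_carrier n) :
  KMag_pcomp i (a *: x + x') y = a *: KMag_pcomp i x y + KMag_pcomp i x' y.
Proof.
rewrite scaler_sumr -big_split; apply: eq_bigr => s _ /=.
rewrite scaler_sumr -big_split; apply: eq_bigr => t _ /=.
by rewrite !ffunE mulrDl scalerDl scalerA mulrA.
Qed.

Fact KMag_pcompDr m n (i : 'I_m) a (x : KMag_carrier m) (y y' : KMag_carrier n) :
  KMag_pcomp i x (a *: y + y') = a *: KMag_pcomp i x y + KMag_pcomp i x y'.
Proof.
rewrite scaler_sumr -big_split; apply: eq_bigr => s _ /=.
rewrite scaler_sumr -big_split; apply: eq_bigr => t _ /=.
by rewrite !ffunE mulrDr scalerDl scalerA mulrCA.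
Qed.

Lemma KMag_pcomp_suml m n (i : 'I_m) (T : finType) (c : T -> K) f
    (y : KMag_carrier n) :
  KMag_pcomp i (\sum_t c t *: f t) y = \sum_t c t *: KMag_pcomp i (f t) y.
Proof.
apply: (big_ind2 (fun x z => KMag_pcomp i x y = z)) => [|x _ x' _ <- <-|t _].
- by rewrite /KMag_pcomp big1 // => s _; rewrite big1 // => t _;
    rewrite ffunE mul0r scale0r.
- by rewrite -[x]scale1r KMag_pcompDl !scale1r.
- rewrite -[_ *: f t]addr0 KMag_pcompDl.
  rewrite [X in _ + X](_ : _ = 0) ?addr0 //.
  by rewrite /KMag_pcomp big1 // => s _; rewrite big1 // => u _;
    rewrite ffunE mul0r scale0r.
Qed.

Lemma KMag_pcomp_sumr m n (i : 'I_m) (T : finType) (c : T -> K) f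
    (x : KMag_carrier m) :
  KMag_pcomp i x (\sum_t c t *: f t : KMag_carrier n)
  = \sum_t c t *: KMag_pcomp i x (f t).
Proof.
apply: (big_ind2 (fun y z => KMag_pcomp i x y = z)) => [|y _ y' _ <- <-|t _].
- by rewrite /KMag_pcomp big1 // => s _; rewrite big1 // => t _;
    rewrite ffunE mulr0 scale0r.
- by rewrite -[y]scale1r KMag_pcompDr !scale1r.
- rewrite -[_ *: f t]addr0 KMag_pcompDr.
  rewrite [X in _ + X](_ : _ = 0) ?addr0 //.
  by rewrite /KMag_pcomp big1 // => s _; rewrite big1 // => u _;
    rewrite ffunE mulr0 scale0r.
Qed.

Lemma KMag_pcomp_tree m n (i : 'I_m) (s : Mag m) (t : Mag n) :
  KMag_pcomp i (tree_vec s) (tree_vec t) = tree_vec (mag_graft i s t).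
Proof.
rewrite /KMag_pcomp (bigD1 s) //= [X in _ + X]big1 => [|s' /negPf ss'].
  rewrite addr0 (bigD1 t) //= big1 => [|t' /negPf tt'].
    by rewrite !ffunE !eqxx mulr1 scale1r addr0.
  by rewrite [X in _ * X]ffunE tt' mulr0 scale0r.
by rewrite big1 // => t' _; rewrite ffunE ss' mul0r scale0r.
Qed.

Lemma existT_tree_sum m n (T : finType) (c : T -> K)
    (f : T -> Mag m) (g : T -> Mag n) :
  m = n -> (forall t, val (f t) = val (g t)) ->
  existT KMag_carrier m (\sum_t c t *: tree_vec (f t))
  = existT KMag_carrier n (\sum_t c t *: tree_vec (g t)).
Proof.
move=> mn; case: n / mn g => g fg; congr existT; apply: eq_bigr => t _.
by congr (_ *: tree_vec _); apply: val_inj.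
Qed.

Fact KMag_pcomp1 m (i : 'I_m) (x : KMag_carrier m) :
  existT KMag_carrier _ (KMag_pcomp i x KMag_unit) = existT KMag_carrier m x.
Proof.
rewrite [x in LHS]tree_vecE [x in RHS]tree_vecE KMag_pcomp_suml.
under eq_bigr do rewrite KMag_pcomp_tree.
by apply: existT_tree_sum => [|t /=]; [rewrite addn1 | rewrite graft_leaf].
Qed.

Fact KMag_pcomp_1 n (y : KMag_carrier n) : KMag_pcomp ord0 KMag_unit y = y.
Proof.
rewrite [y in LHS]tree_vecE [y in RHS]tree_vecE KMag_pcomp_sumr.
apply: eq_bigr => t _; rewrite KMag_pcomp_tree.
by congr (_ *: tree_vec _); apply: val_inj.
Qed.

Lemma KMag_trilinear m n p q (f : KMag_carrier m -> KMag_carrier n ->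
    KMag_carrier p -> KMag_carrier q) x y z :
  (forall y z (c : Mag m -> K) g,
     f (\sum_t c t *: g t) y z = \sum_t c t *: f (g t) y z) ->
  (forall x z (c : Mag n -> K) g,
     f x (\sum_t c t *: g t) z = \sum_t c t *: f x (g t) z) ->
  (forall x y (c : Mag p -> K) g,
     f x y (\sum_t c t *: g t) = \sum_t c t *: f x y (g t)) ->
  f x y z = \sum_(t : Mag m * Mag n * Mag p) (x t.1.1 * (y t.1.2 * z t.2)) *:
    f (tree_vec t.1.1) (tree_vec t.1.2) (tree_vec t.2).
Proof.
move=> fx fy fz; rewrite {1}[x]tree_vecE {1}[y]tree_vecE {1}[z]tree_vecE fx.
transitivity (\sum_(r : Mag m) \sum_(s : Mag n) \sum_(t : Mag p)
    (x r * (y s * z t)) *: f (tree_vec r) (tree_vec s) (tree_vec t)).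
  apply: eq_bigr => r _; rewrite fy scaler_sumr; apply: eq_bigr => s _.
  by rewrite fz !scaler_sumr; apply: eq_bigr => t _; rewrite !scalerA mulrA.
by rewrite pair_bigA pair_bigA.
Qed.

Fact KMag_pcomp_seq m n p (i : 'I_m) (j : 'I_n) (k : 'I_(m + n).-1)
    (x : KMag_carrier m) (y : KMag_carrier n) (z : KMag_carrier p) :
  k = (i + j)%N :> nat ->
  existT KMag_carrier _ (KMag_pcomp k (KMag_pcomp i x y) z)
  = existT KMag_carrier _ (KMag_pcomp i x (KMag_pcomp j y z)).
Proof.
move=> kE.
rewrite (@KMag_trilinear _ _ _ _ (fun x y z => KMag_pcomp k (KMag_pcomp i x y) z));
  try by move=> *; rewrite ?(KMag_pcomp_suml, KMag_pcomp_sumr).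
rewrite (@KMag_trilinear _ _ _ _ (fun x y z => KMag_pcomp i x (KMag_pcomp j y z)));
  try by move=> *; rewrite ?(KMag_pcomp_suml, KMag_pcomp_sumr).
under eq_bigr do rewrite !KMag_pcomp_tree.
under [in RHS]eq_bigr do rewrite !KMag_pcomp_tree.
apply: existT_tree_sum => [|[[r s] t] /=]; first by have := ltn_ord j; lia.
by rewrite kE graft_seq // ?(eqP (valP r)) ?(eqP (valP s)).
Qed.

Fact KMag_pcomp_par m n p (i k : 'I_m)
    (k' : 'I_(m + n).-1) (i' : 'I_(m + p).-1)
    (x : KMag_carrier m) (y : KMag_carrier n) (z : KMag_carrier p) :
  (i < k)%N -> k' = (k + n).-1%N :> nat -> i' = i :> nat ->
  existT KMag_carrier _ (KMag_pcomp k' (KMag_pcomp i x y) z)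
  = existT KMag_carrier _ (KMag_pcomp i' (KMag_pcomp k x z) y).
Proof.
move=> ik k'E i'E.
rewrite (@KMag_trilinear _ _ _ _ (fun x y z => KMag_pcomp k' (KMag_pcomp i x y) z));
  try by move=> *; rewrite ?(KMag_pcomp_suml, KMag_pcomp_sumr).
rewrite (@KMag_trilinear _ _ _ _ (fun x y z => KMag_pcomp i' (KMag_pcomp k x z) y));
  try by move=> *; rewrite ?(KMag_pcomp_suml, KMag_pcomp_sumr).
under eq_bigr do rewrite !KMag_pcomp_tree.
under [in RHS]eq_bigr do rewrite !KMag_pcomp_tree.
apply: existT_tree_sum => [|[[r s] t] /=].
  by have := ltn_ord k; have := ltn_ord k'; have := ltn_ord i'; lia.
have := @graft_par (val r) (val s) (val t) i k.
by rewrite k'E i'E (eqP (valP s)) (eqP (valP r)) ik ltn_ord; apply.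
Qed.

Definition KMag : ns_operad K :=
  NsOperad KMag_pcompDl KMag_pcompDr KMag_pcomp1 KMag_pcomp_1
    KMag_pcomp_seq KMag_pcomp_par.

Definition I_As : operad_ideal KMag := gen_ideal
  [set graded (O := KMag) (n := 3) (tree_vec (LComb 2) - tree_vec (RComb 2))].

Definition I_AAs : operad_ideal KMag := gen_ideal
  [set graded (O := KMag) (n := 3) (tree_vec (LComb 2) + tree_vec (RComb 2))].

Definition I_2Nil : operad_ideal KMag := gen_ideal
  [set graded (O := KMag) (n := 3) (tree_vec (LComb 2));
       graded (O := KMag) (n := 3) (tree_vec (RComb 2))].

Definition I_RC3 : operad_ideal KMag := gen_ideal
  [set graded (O := KMag) (n := 4) (tree_vec t - tree_vec (RComb 3)) | t in [set: Mag 4]].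

Definition KAs : operad_quotient KMag := OperadQuotient I_As.
Definition AAs : operad_quotient KMag := OperadQuotient I_AAs.
Definition TwoNil : operad_quotient KMag := OperadQuotient I_2Nil.
Definition KRC3 : operad_quotient KMag := OperadQuotient I_RC3.

End KMag.

(* Main.v *)
(** The rotations between the five trees with 4 leaves form a pentagon, an odd
    cycle.  If each rotation costs a sign, the trees with 4 leaves
    therefore vanish in characteristic not 2, so [I_AAs] is everything in arity
    at least 4, and contains [I_RC3].  In these arities [I_As] is the set of
    vectors with coefficient sum 0, and it equals [I_RC3] because any rotation
    inside a tree with at least 4 leaves happens inside a pattern with exactly
    4 leaves.  In arity at most 3 the intersection is trivial: this is seen by
    evaluating linear forms on trees whose kernels are ideals. *)

Require Import Defs.
From mathcomp Require Import all_boot all_algebra.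
From mathcomp Require Import classical_sets.
From mathcomp Require Import zify ring.

Set Implicit Arguments.
Unset Strict Implicit.
Unset Printing Implicit Defensive.

Import GRing.Theory.

Local Open Scope ring_scope.

(** * Closure properties of operad ideals *)

Section IdealClosure.
Variables (K : fieldType) (O : ns_operad K) (I : operad_ideal O) (n : nat).
Implicit Types x y : O n.

Lemma idealD x y : I n x -> I n y -> I n (x + y).
Proof. by rewrite -{2}[x]scale1r; apply: idealP. Qed.

Lemma idealZ a x : I n x -> I n (a *: x).
Proof. by move=> Ix; rewrite -[_ *: _]addr0; apply: idealP => //; apply: ideal0. Qed.

Lemma idealB x y : I n x -> I n y -> I n (x - y).
Proof. by move=> Ix Iy; apply: idealD => //; rewrite -scaleN1r; apply: idealZ. Qed.

Lemma ideal_lincomb (T : finType) (c : T -> K) (f : T -> O n) :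
  (forall t, I n (f t)) -> I n (\sum_t c t *: f t).
Proof.
move=> If; apply: big_ind => [|x y|t _]; [exact: ideal0 | exact: idealD |].
exact: idealZ.
Qed.

End IdealClosure.

Lemma pcompBl (K : fieldType) (O : ns_operad K) m n (i : 'I_m) a (x x' : O m)
  (y : O n) : Defs.pcomp i (x - a *: x') y = Defs.pcomp i x y - a *: Defs.pcomp i x' y.
Proof. by rewrite addrC -scaleNr pcompDl scaleNr addrC. Qed.

Lemma pcompBr (K : fieldType) (O : ns_operad K) m n (i : 'I_m) a (x : O m)
  (y y' : O n) : Defs.pcomp i x (y - a *: y') = Defs.pcomp i x y - a *: Defs.pcomp i x y'.
Proof. by rewrite addrC -scaleNr pcompDr scaleNr addrC. Qed.

Lemma gen_ideal_mem (K : fieldType) (O : ns_operad K) (G : set {n & O n}) n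
  (x : O n) : G (graded x) -> gen_ideal G n x.
Proof. by move=> Gx J /(_ _ Gx). Qed.

Lemma operad_ideal_eq (K : fieldType) (O : ns_operad K) (I J : operad_ideal O) :
  (forall n x, I n x -> J n x) -> (forall n x, J n x -> I n x) -> I = J.
Proof. by move=> IJ JI; apply: operad_ideal_ext => n; apply/seteqP; split => x; [exact: IJ | exact: JI]. Qed.

(** * Trees with at most three leaves *)

Lemma leaves1 t : leaves t = 1%N -> t = Leaf.
Proof.
by case: t => //= l r; have := leaves_gt0 l; have := leaves_gt0 r; lia.
Qed.

Lemma leaves2 t : leaves t = 2 -> t = rcomb 1.
Proof.
case: t => //= l r lr; have := leaves_gt0 l; have := leaves_gt0 r => r0 l0.
by rewrite [l]leaves1 1?[r]leaves1 //; lia.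
Qed.

Lemma leaves3 t : leaves t = 3 -> t = lcomb 2 \/ t = rcomb 2.
Proof.
case: t => //= l r lr; have := leaves_gt0 l; have := leaves_gt0 r => r0 l0.
have [l1|l2] : leaves l = 1%N \/ leaves l = 2 by lia.
  by right; rewrite [l]leaves1 1?[r]leaves2 //; lia.
by left; rewrite [l]leaves2 1?[r]leaves1 //; lia.
Qed.

(** * Basis vectors and congruence of trees modulo an ideal *)

Section TreeVectors.
Variable K : fieldType.

(* Indexing by bare trees avoids casts between propositionally equal arities;
   the vector is [0] when [t] does not have [n] leaves. *)
Definition tvec n (t : bintree) : KMag K n :=
  ([ffun s : Mag n => (val s == t)%:R : K^o] : KMag_carrier K n).

Lemma tvecE n (t : Mag n) : tvec n (val t) = tree_vec K t.
Proof. by apply/ffunP => s; rewrite !ffunE. Qed.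

Lemma pcomp_tvec m n (i : 'I_m) s t : leaves s = m -> leaves t = n ->
  Defs.pcomp i (tvec m s) (tvec n t) = tvec (m + n).-1 (graft s i t).
Proof.
move=> sm tn; pose s' : Mag m := Sub s (introT eqP sm).
pose t' : Mag n := Sub t (introT eqP tn).
rewrite -[s]/(val s') -[t in LHS]/(val t') !tvecE.
by rewrite [LHS]KMag_pcomp_tree -tvecE.
Qed.

Section Congruence.
Variable I : operad_ideal (KMag K).

(** The scalar [a] records the cost of rewriting [s] into [t], so that one calculus serves both
    [I_As] (with [a = 1]) and [I_AAs] (with [a = -1]). *)
Definition tcong a s t :=
  leaves s = leaves t /\ I _ (tvec (leaves s) s - a *: tvec _ t).

Lemma tcong_refl s : tcong 1 s s.
Proof. by split=> //; rewrite scale1r subrr; apply: ideal0. Qed.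

Lemma tcong_trans a b s t u : tcong a s t -> tcong b t u -> tcong (a * b) s u.
Proof.
move=> [st Ist] [tu Itu]; split; first by rewrite st.
rewrite -st in Itu.
have := idealD Ist (idealZ a Itu).
by rewrite scalerBr scalerA addrA subrK.
Qed.

Lemma tcong_graftl a s t u i : (i < leaves s)%N -> tcong a s t ->
  tcong a (graft s i u) (graft t i u).
Proof.
move=> si [st Ist]; split; first by rewrite !leaves_graft -?st.
rewrite leaves_graft //.
have := ideal_pcompl (Ordinal si) (tvec (leaves u) u) Ist.
by rewrite pcompBl !pcomp_tvec.
Qed.

Lemma tcong_graftr a s t u i : (i < leaves u)%N -> tcong a s t ->
  tcong a (graft u i s) (graft u i t).
Proof.
move=> ui [st Ist]; split; first by rewrite !leaves_graft -?st.
rewrite leaves_graft //.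
have := ideal_pcompr (Ordinal ui) (tvec (leaves u) u) Ist.
by rewrite pcompBr !pcomp_tvec.
Qed.

Lemma tcong_Nodel a s s' t : tcong a s s' -> tcong a (Node s t) (Node s' t).
Proof. exact: (@tcong_graftr _ _ _ (Node Leaf t) 0). Qed.

Lemma tcong_Noder a s t t' : tcong a t t' -> tcong a (Node s t) (Node s t').
Proof.
move=> /(@tcong_graftr _ _ _ (Node s Leaf) (leaves s)) /=.
by rewrite ltnn; apply; rewrite addn1.
Qed.

(** Both sides arise from the two combs by grafting [z], [y], [x] onto leaves 2, 1, 0. Going from
    right to left keeps the numbers of the remaining leaves unchanged. *)
Lemma tcong_rotation a x y z : tcong a (lcomb 2) (rcomb 2) ->
  tcong a (Node (Node x y) z) (Node x (Node y z)).
Proof.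
move=> /(@tcong_graftl a (lcomb 2) (rcomb 2) z 2 isT).
move=> /(@tcong_graftl a _ _ y 1); move/(_ isT).
by move=> /(@tcong_graftl a _ _ x 0); apply.
Qed.

(* The two sides of the pentagon of rotations have lengths 3 and 2. *)
Lemma tcong_pentagon a : tcong a (lcomb 2) (rcomb 2) ->
  tcong (a ^+ 3) (lcomb 3) (rcomb 3) /\ tcong (a ^+ 2) (lcomb 3) (rcomb 3).
Proof.
move=> LR; have rot x y z := tcong_rotation x y z LR; split.
  rewrite exprS expr2; apply: tcong_trans (tcong_Nodel Leaf (rot _ _ _)) _.
  by apply: tcong_trans (rot _ _ _) (tcong_Noder Leaf (rot _ _ _)).
by rewrite expr2; apply: tcong_trans (rot _ _ _) (rot _ _ _).
Qed.

(** The number [k] of rotations may stay unspecified: for [a = 1] the power is 1, and for [a = -1]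
    its sign is irrelevant once [rcomb 3] itself lies in the ideal. *)
Lemma tcong_rcomb3 a t : tcong a (lcomb 2) (rcomb 2) -> leaves t = 4 ->
  exists k, tcong (a ^+ k) t (rcomb 3).
Proof.
move=> LR t4; have rot x y z := tcong_rotation x y z LR.
have [L3 _] := tcong_pentagon LR.
case: t t4 => //= l r lr; have l0 := leaves_gt0 l; have r0 := leaves_gt0 r.
have [l1|[l2|l3]] : leaves l = 1%N \/ leaves l = 2 \/ leaves l = 3 by lia.
- have r3 : leaves r = 3 by lia.
  rewrite (leaves1 l1); have [->|->] := leaves3 r3.
    by exists 1%N; rewrite expr1; apply/tcong_Noder/rot.
  by exists 0%N; rewrite expr0; apply: tcong_refl.
- have r2 : leaves r = 2 by lia.
  by exists 1%N; rewrite (leaves2 l2) (leaves2 r2) expr1; apply: rot.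
- have r1 : leaves r = 1%N by lia.
  rewrite (leaves1 r1); have [->|->] := leaves3 l3; first by exists 3.
  exists 2; rewrite expr2.
  by apply: tcong_trans (rot _ _ _) (tcong_Noder Leaf (rot _ _ _)).
Qed.

Lemma tcong_sym s t : tcong 1 s t -> tcong 1 t s.
Proof.
move=> [st Ist]; split=> //; rewrite -st; move/(idealZ (-1)): Ist.
by rewrite scaleN1r !scale1r opprB.
Qed.

Definition graft4 p x y z u := graft (graft (graft (graft p 3 u) 2 z) 1 y) 0 x.

Lemma tcong_graft4 a p q x y z u : leaves p = 4 -> tcong a p q ->
  tcong a (graft4 p x y z u) (graft4 q x y z u).
Proof.
move=> p4 pq; have [y0 z0 u0] := And3 (leaves_gt0 y) (leaves_gt0 z) (leaves_gt0 u).
have e3 : leaves (graft p 3 u) = (3 + leaves u)%N by rewrite leaves_graft p4.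
have e2 : leaves (graft (graft p 3 u) 2 z) = (2 + leaves z + leaves u)%N.
  by rewrite leaves_graft e3 //; lia.
have e1 : leaves (graft (graft (graft p 3 u) 2 z) 1 y)
    = (1 + leaves y + leaves z + leaves u)%N.
  by rewrite leaves_graft e2 //; lia.
apply: tcong_graftl; first by rewrite e1; lia.
apply: tcong_graftl; first by rewrite e2; lia.
apply: tcong_graftl; first by rewrite e3; lia.
by apply: tcong_graftl; first by rewrite p4.
Qed.

(* Any two adjacent inner nodes of a tree with at least 4 leaves lie in a
   connected pattern of three inner nodes, so every rotation is available. *)
Lemma tcong_rcomb : (forall t, leaves t = 4 -> tcong 1 t (rcomb 3)) ->
  forall t, (3 < leaves t)%N -> tcong 1 t (rcomb (leaves t).-1).
Proof.
move=> H4 t; move: {2}(leaves t) (erefl (leaves t)) => n.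
elim/ltn_ind: n t => n IHn [|l r] //= lr; rewrite lr => n4.
have r0 := leaves_gt0 r.
(* Inner induction on the left subtree: the tree is replaced by congruent ones with a smaller left
   subtree, until this is a leaf and the outer induction handles the right subtree. *)
move: {2}(leaves l) (erefl (leaves l)) => m.
elim/ltn_ind: m l r r0 lr => m IHm [|a b] r r0 lr lm.
  (* If the right subtree has only 3 leaves, the outer hypothesis does not reach it, but the whole
     tree then has 4 leaves and [H4] applies. *)
  rewrite /= in lr; have [r3|r3] := eqVneq (leaves r) 3.
    by rewrite -lr r3; apply: H4; rewrite /= r3.
  have -> : n.-1 = (leaves r).-1.+1 by lia.
  by apply/tcong_Noder/(IHn (leaves r)); lia.
have H p q x y z u : leaves p = 4 -> leaves q = 4 ->
    tcong 1 (graft4 p x y z u) (graft4 q x y z u).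
  move=> p4 q4; apply: tcong_graft4 => //; rewrite -[1]mulr1.
  exact: tcong_trans (H4 _ p4) (tcong_sym (H4 _ q4)).
have step a' b' : (leaves a' < leaves (Node a b))%N ->
    tcong 1 (Node (Node a b) r) (Node a' b') ->
    tcong 1 (Node (Node a b) r) (rcomb n.-1).
  move=> a'l cab; rewrite -[1]mulr1; apply: (tcong_trans cab).
  have [e _] := cab; rewrite /= in e lr.
  by apply: (IHm (leaves a')); rewrite ?leaves_gt0 -?lm -?e.
have a0 := leaves_gt0 a; have b0 := leaves_gt0 b.
(* With at least 4 leaves, one of [r], [b], [a] is a node. Together with the root and its left child
   it forms a pattern with 4 leaves, which [H] turns into [rcomb 3]. *)
case: r r0 lr step => [|c d] r0 lr step; last first.
  apply: (step a (Node b (Node c d))); first by rewrite /=; lia.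
  exact: (H (Node (rcomb 1) (rcomb 1)) (rcomb 3) a b c d).
case: b lr lm b0 step => [|b1 b2] lr lm b0 step; last first.
  apply: (step a (Node b1 (Node b2 Leaf))); first by move: b0; rewrite /=; lia.
  exact: (H (Node (rcomb 2) Leaf) (rcomb 3) a b1 b2 Leaf).
case: a lr lm a0 step => [|a1 a2] lr lm a0 step; first by rewrite /= in lr; lia.
apply: (step a1 (Node a2 (Node Leaf Leaf))); first by rewrite /=; lia.
exact: (H (lcomb 3) (rcomb 3) a1 a2 Leaf Leaf).
Qed.

Lemma tcong_Mag n (s t : Mag n) : tcong 1 (val s) (val t) ->
  I n (tree_vec K s - tree_vec K t).
Proof. by case=> _; rewrite scale1r (eqP (valP s)) !tvecE. Qed.

(** When the coefficients sum to 0, subtracting [t0] from every basis tree does not change the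
    combination, and each difference lies in [I]. *)
Lemma tcong_sumr0 n (t0 : Mag n) (x : KMag_carrier K n) :
  (forall t : Mag n, tcong 1 (val t) (val t0)) -> \sum_t x t = 0 -> I n x.
Proof.
move=> ct0 x0; rewrite [x]tree_vecE.
have -> : \sum_t x t *: tree_vec K t = \sum_t x t *: (tree_vec K t - tree_vec K t0).
  under [RHS]eq_bigr do rewrite scalerBr.
  by rewrite sumrB -scaler_suml x0 scale0r subr0.
by apply: (@ideal_lincomb _ (KMag K)) => t; apply: tcong_Mag.
Qed.

End Congruence.

(** * Linear forms on trees whose kernels are ideals *)

Section Weights.
Variable w : bintree -> K.

Definition weight n (x : KMag_carrier K n) : K := \sum_t x t * w (val t).

Lemma weightP n a (x y : KMag_carrier K n) :
  weight (a *: x + y) = a * weight x + weight y.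
Proof.
rewrite /weight mulr_sumr -big_split; apply: eq_bigr => t _ /=.
by rewrite !ffunE mulrDl mulrA.
Qed.

Lemma weight0 n : weight (0 : KMag_carrier K n) = 0.
Proof. by rewrite /weight big1 // => t _; rewrite ffunE mul0r. Qed.

Lemma weight_tree n (t : Mag n) : weight (tree_vec K t) = w (val t).
Proof.
rewrite /weight (bigD1 t) //= big1 => [|s /negPf st]; rewrite ffunE.
  by rewrite eqxx mul1r addr0.
by rewrite st mul0r.
Qed.

Lemma weight_lincomb n (T : finType) (c : T -> K) (f : T -> KMag_carrier K n) :
  weight (\sum_t c t *: f t) = \sum_t c t * weight (f t).
Proof.
apply: (big_ind2 (fun (z : KMag_carrier K n) a => weight z = a)) => [|x a y b <- <-|t _].
- exact: weight0.
- by rewrite -[x]scale1r weightP scale1r mul1r.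
- by rewrite -[_ *: f t]addr0 weightP weight0 addr0.
Qed.

Variable e : nat -> nat -> nat -> K.
Hypothesis w_graft : forall s t i, (i < leaves s)%N ->
  w (graft s i t) = e (leaves s) (leaves t) i * (w s * w t).

Lemma weight_pcomp m n (i : 'I_m) (x : KMag_carrier K m) (y : KMag_carrier K n) :
  weight (KMag_pcomp i x y) = e m n i * (weight x * weight y).
Proof.
rewrite /weight mulr_suml mulr_sumr -/(weight _).
rewrite [x in LHS]tree_vecE KMag_pcomp_suml weight_lincomb.
apply: eq_bigr => s _; rewrite [y in LHS]tree_vecE KMag_pcomp_sumr weight_lincomb.
rewrite !mulr_sumr; apply: eq_bigr => t _.
rewrite KMag_pcomp_tree weight_tree /= w_graft (eqP (valP s)) ?(eqP (valP t)) //.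
by ring.
Qed.

(* Multiplicativity up to a factor depending only on arities and position makes
   the kernel of [w] an ideal. *)
Lemma is_operad_ideal_weight :
  is_operad_ideal (O := KMag K) (fun n => [set x | weight x = 0]%classic).
Proof.
split=> [n|m n i x y /= x0|m n i x y /= y0].
- apply/submod_closed_setP; split=> [|a x y /= x0 y0] /=; first exact: weight0.
  by rewrite weightP x0 y0 mulr0 addr0.
- by rewrite weight_pcomp x0 mul0r mulr0.
- by rewrite weight_pcomp y0 !mulr0.
Qed.

Lemma gen_ideal_weight0 (G : set {n & KMag K n}) n (x : KMag K n) :
  (forall g, G g -> weight (projT2 g) = 0) -> gen_ideal G n x -> weight x = 0.
Proof. by move=> Gw Ix; apply: (Ix (OperadIdeal is_operad_ideal_weight) Gw). Qed.

End Weights.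

(** The constant weight gives the coefficient sum; it is multiplicative with factor 1 and kills the
    generator. *)
Lemma I_As_weight n (x : KMag_carrier K n) : I_As K n x -> weight (fun=> 1) x = 0.
Proof.
apply: (@gen_ideal_weight0 _ (fun _ _ _ => 1)) => [*|_ ->] /=.
  by rewrite !mul1r.
rewrite -[tree_vec _ _]scale1r addrC -scaleN1r weightP !scale1r !weight_tree.
by ring.
Qed.

(* The signed form induced by AAs on the 1-dimensional arities 1, 2, 3. *)
Definition AAs_weight t : K :=
  if (leaves t <= 3)%N then (-1) ^+ (t == rcomb 2) else 0.

(** Grafting a single leaf, or grafting onto it, costs nothing. For [m = n = 2], position 0 gives
    [lcomb 2] and position 1 gives [rcomb 2], hence the sign [(-1) ^+ i]. All other grafts have at
    least 4 leaves, where the weight vanishes. *)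
Definition AAs_factor (m n i : nat) : K :=
  if (m == 1%N) || (n == 1%N) then 1
  else if (m + n <= 4)%N then (-1) ^+ i else 0.

Lemma AAs_weight_graft s t i : (i < leaves s)%N ->
  AAs_weight (graft s i t) =
  AAs_factor (leaves s) (leaves t) i * (AAs_weight s * AAs_weight t).
Proof.
rewrite /AAs_factor.
move=> si; have s0 := leaves_gt0 s; have t0 := leaves_gt0 t.
have w1 : AAs_weight Leaf = 1 by [].
case: eqP => [/leaves1 ->|s1] /=; first by rewrite w1 !mul1r.
case: eqP => [/leaves1 ->|t1] /=; first by rewrite graft_leaf w1 mulr1 mul1r.
case: leqP => st4; last by rewrite mul0r /AAs_weight leaves_graft // ifF //; lia.
have s2 : leaves s = 2 by lia.
rewrite (leaves2 s2) in si *; rewrite (@leaves2 t); last by lia.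
by case: i si => [|[|i]] // _; rewrite /AAs_weight /= !expr0 ?expr1 ?mulr1.
Qed.

Lemma I_AAs_weight n (x : KMag_carrier K n) : I_AAs K n x -> weight AAs_weight x = 0.
Proof.
apply: (@gen_ideal_weight0 _ AAs_factor) => [|_ ->] /=; first exact: AAs_weight_graft.
rewrite -[tree_vec _ _]scale1r weightP !weight_tree /AAs_weight /=.
by rewrite expr0 expr1; ring.
Qed.

Lemma sum_Mag_eq0 n (x : KMag_carrier K n) :
  (forall s t : Mag n, s = t) -> \sum_t x t = 0 -> x = 0.
Proof.
move=> Mag1 x0; apply/ffunP => t; rewrite ffunE -[RHS]x0.
by rewrite (bigD1 t) //= big1 ?addr0 // => s /eqP; case; apply: Mag1.
Qed.

(** * The generators read as congruences *)

Lemma tcong_As : tcong (I_As K) 1 (lcomb 2) (rcomb 2).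
Proof.
split=> //=; rewrite scale1r (tvecE (LComb 2)) (tvecE (RComb 2)).
exact: gen_ideal_mem.
Qed.

Lemma tcong_AAs : tcong (I_AAs K) (-1) (lcomb 2) (rcomb 2).
Proof.
split=> //=; rewrite scaleN1r opprK (tvecE (LComb 2)) (tvecE (RComb 2)).
exact: gen_ideal_mem.
Qed.

Lemma tcong_RC3 t : leaves t = 4 -> tcong (I_RC3 K) 1 t (rcomb 3).
Proof.
move=> t4; split=> //; rewrite scale1r t4 (tvecE (RComb 3)).
rewrite (tvecE (Sub t (introT eqP t4) : Mag 4)).
by apply: gen_ideal_mem; exists (Sub t (introT eqP t4)).
Qed.

(** * Sum and intersection when 2 is invertible *)

Section CharNot2.
Hypothesis K2 : 2 != 0 :> K.

Lemma I_AAs4 (t : Mag 4) : I_AAs K 4 (tree_vec K t).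
Proof.
have [[_ p3] [_ p2]] := tcong_pentagon tcong_AAs.
have r3 : I_AAs K 4 (tvec 4 (rcomb 3)).
  (* The two sides of the pentagon give opposite signs; in their difference [lcomb 3] cancels and
     [2 *: rcomb 3] remains. *)
  have := idealZ 2^-1 (idealB p3 p2); rewrite [leaves _]/=.
  rewrite opprB addrC addrA subrK -scalerBl scalerA.
  have -> : (-1) ^+ 2 - (-1) ^+ 3 = 2 :> K by ring.
  by rewrite mulVf ?scale1r.
have [k [_]] := tcong_rcomb3 tcong_AAs (eqP (valP t)).
rewrite (eqP (valP t)) tvecE => tr.
by have := idealD tr (idealZ ((-1) ^+ k) r3); rewrite subrK.
Qed.

Lemma ideal_sum_As_AAs : ideal_sum (I_As K) (I_AAs K) = I_2Nil K.
Proof.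
have L : I_2Nil K 3 (tree_vec K (LComb 2)) by apply: gen_ideal_mem; left.
have R : I_2Nil K 3 (tree_vec K (RComb 2)) by apply: gen_ideal_mem; right.
have m : I_As K 3 (tree_vec K (LComb 2) - tree_vec K (RComb 2)).
  exact: gen_ideal_mem.
have p : I_AAs K 3 (tree_vec K (LComb 2) + tree_vec K (RComb 2)).
  exact: gen_ideal_mem.
apply: operad_ideal_eq => n x.
  case=> y Iy [z Iz <-]; apply: idealD.
    by apply: Iy => _ -> /=; apply: (idealB L R).
  by apply: Iz => _ -> /=; apply: (idealD L R).
apply=> _ [] -> /=.
(* Each comb is half the sum of the two generators, the first one being negated for [RComb 2]. *)
- exists (2^-1 *: (tree_vec K (LComb 2) - tree_vec K (RComb 2))); first exact: (idealZ _ m).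
  exists (2^-1 *: (tree_vec K (LComb 2) + tree_vec K (RComb 2))); first exact: (idealZ _ p).
  by rewrite -scalerDr addrACA addNr addr0 -mulr2n -scaler_nat scalerA mulVf ?scale1r.
- exists (- 2^-1 *: (tree_vec K (LComb 2) - tree_vec K (RComb 2))); first exact: (idealZ _ m).
  exists (2^-1 *: (tree_vec K (LComb 2) + tree_vec K (RComb 2))); first exact: (idealZ _ p).
  rewrite scaleNr -scalerN opprB -scalerDr addrA subrK.
  by rewrite -mulr2n -scaler_nat scalerA mulVf ?scale1r.
Qed.

Lemma ideal_cap_As_AAs : ideal_cap (I_As K) (I_AAs K) = I_RC3 K.
Proof.
apply: operad_ideal_eq => n x; last first.
  move=> Ix; split; apply: Ix => _ [t _ <-] /=; last exact: (idealB (I_AAs4 t) (I_AAs4 _)).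
  have [k] := tcong_rcomb3 tcong_As (eqP (valP t)).
  by rewrite expr1n => /(tcong_Mag (t := RComb 3)).
case=> /I_As_weight + /I_AAs_weight; rewrite /weight.
under eq_bigr do rewrite mulr1.
move=> x0 wx0; have [n4|n3] := ltnP 3 n.
  case: n n4 x x0 {wx0} => // n n4 x x0.
  apply: (@tcong_sumr0 (I_RC3 K) _ (RComb n) x _ x0) => t /=.
  by have := tcong_rcomb tcong_RC3 (t := val t); rewrite (eqP (valP t)); apply.
suff -> : x = 0 by apply: (ideal0 (I_RC3 K) n).
case: n n3 x x0 wx0 => [|[|[|[|]]]] // _ x x0 wx0.
- apply: sum_Mag_eq0 x0 => -[s /= s0]; by have := leaves_gt0 s; rewrite (eqP s0).
- apply: sum_Mag_eq0 x0 => s t; apply: val_inj.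
  by rewrite (leaves1 (eqP (valP s))) (leaves1 (eqP (valP t))).
- apply: sum_Mag_eq0 x0 => s t; apply: val_inj.
  by rewrite (leaves2 (eqP (valP s))) (leaves2 (eqP (valP t))).
have sum3 (f : Mag 3 -> K) : \sum_t f t = f (LComb 2) + f (RComb 2).
  rewrite (bigD1 (LComb 2)) // (bigD1 (RComb 2)) //= big1 ?addr0 // => t.
  by case: (leaves3 (eqP (valP t))) => tE; rewrite -!val_eqE /= tE.
rewrite !sum3 /AAs_weight /= expr0 expr1 in x0 wx0.
(* In arity 3 the two forms are the sum and the difference of the two coefficients; subtracting them
   leaves twice the coefficient of [RComb 2]. *)
have R0 : x (RComb 2) = 0.
  apply: (mulfI K2); rewrite mulr0; transitivity (0 - 0 : K); last by ring.
  by rewrite -[X in X - _]x0 -wx0; ring.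
have L0 : x (LComb 2) = 0 by rewrite -x0 R0 addr0.
apply/ffunP => t; rewrite ffunE.
by case: (leaves3 (eqP (valP t))) => tE; [rewrite -[RHS]L0 | rewrite -[RHS]R0];
  congr (x _); apply: val_inj.
Qed.

End CharNot2.
End TreeVectors.

Theorem theorem2p2p3 (K : fieldType) (charK0 : [pchar K] =i pred0) :
  [/\ meet_i (KAs K) (AAs K) = TwoNil K :> ns_operad K,
      join_i (KAs K) (AAs K) = KRC3 K :> ns_operad K,
      ideal_sum (I_As K) (I_AAs K) = I_2Nil K
    & ideal_cap (I_As K) (I_AAs K) = I_RC3 K].
Proof.
have K2 : 2 != 0 :> K by have /pcharf0P -> := charK0.
have sumE := ideal_sum_As_AAs K2; have capE := ideal_cap_As_AAs K2.
by split=> //; rewrite /meet_i /join_i /= (sumE, capE).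
Qed.
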